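(* Let $\mathbf M\in\mathbb S^n_{++}$ and let $f:\mathbb S^n_{++}\to\mathbb R$ be twice continuously differentiable, with Euclidean gradient $\nabla f(\mathbf X)\in\mathbb S^n$ and Euclidean Hessian $\nabla^2 f(\mathbf X):\mathbb S^n\to\mathbb S^n$ (with respect to $\langle\mathbf A,\mathbf B\rangle=\operatorname{tr}(\mathbf A\mathbf B)$ on $\mathbb S^n$). Then the Riemannian gradient and the Riemannian Hessian of $f$ on $\mathcal M_{\rm gbw}$ at $\mathbf X\in\mathbb S^n_{++}$ are $$\operatorname{grad}f(\mathbf X)=2\mathbf X\nabla f(\mathbf X)\mathbf M+2\mathbf M\nabla f(\mathbf X)\mathbf X$$ and, for every $\mathbf U\in\mathbb S^n$, $$\operatorname{Hess}f(\mathbf X)[\mathbf U]=4\{\mathbf M\nabla^2f(\mathbf X)[\mathbf U]\mathbf X\}_{\rm S}+2\{\mathbf M\nabla f(\mathbf X)\mathbf U\}_{\rm S}+4\{\mathbf X\{\nabla f(\mathbf X)\mathbf M\mathcal L_{\mathbf X,\mathbf M}[\mathbf U]\}_{\rm S}\mathbf M\}_{\rm S}-\{\mathbf M\mathcal L_{\mathbf X,\mathbf M}[\mathbf U]\operatorname{grad}f(\mathbf X)\}_{\rm S}.$$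
   Context: $\mathbb S^n$ is the space of real symmetric $n\times n$ matrices and $\mathbb S^n_{++}$ the open subset of positive definite ones. $\{\mathbf A\}_{\rm S}=\frac12(\mathbf A+\mathbf A^\top)$. For $\mathbf X,\mathbf M\in\mathbb S^n_{++}$ and $\mathbf U\in\mathbb S^n$, $\mathcal L_{\mathbf X,\mathbf M}[\mathbf U]$ is the unique solution $\mathbf L$ of $\mathbf X\mathbf L\mathbf M+\mathbf M\mathbf L\mathbf X=\mathbf U$. $\mathcal M_{\rm gbw}$ is the manifold $\mathbb S^n_{++}$ with the generalized Bures-Wasserstein metric $g_{\rm gbw}(\mathbf U,\mathbf V)=\frac12\operatorname{tr}(\mathcal L_{\mathbf X,\mathbf M}[\mathbf U]\mathbf V)$ at $\mathbf X$, $\mathbf U,\mathbf V\in T_{\mathbf X}\mathbb S^n_{++}=\mathbb S^n$. The Riemannian gradient is the tangent vector with $g_{\rm gbw}(\operatorname{grad}f(\mathbf X),\mathbf V)=\mathrm Df(\mathbf X)[\mathbf V]$ for all $\mathbf V\in\mathbb S^n$; the Riemannian Hessian is $\operatorname{Hess}f(\mathbf X)[\mathbf U]=\nabla_{\mathbf U}\operatorname{grad}f(\mathbf X)$, where $\nabla_{\mathbf U}$ is the Levi-Civita connection of $\mathcal M_{\rm gbw}$. *)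

(* Defs.v *)
From HB Require Import structures.
From mathcomp Require Import all_boot all_order all_algebra.
From mathcomp Require Import all_classical all_reals all_analysis.

Set Implicit Arguments.
Unset Strict Implicit.
Unset Printing Implicit Defensive.

Import Order.TTheory GRing.Theory Num.Theory.
Import numFieldNormedType.Exports.

Local Open Scope classical_set_scope.
Local Open Scope ring_scope.

Definition symmetric_mx {R : realType} {n : nat} : {pred 'M[R]_n} :=
  [pred A : 'M[R]_n | A^T == A].

Lemma symmetric_mx_submod_closed {R : realType} {n : nat} :
  submod_closed (@symmetric_mx R n).
Proof.
split=> [|a A B]; first by rewrite inE trmx0.
by rewrite !inE !linearP /= => /eqP -> /eqP ->.
Qed.

HB.instance Definition _ (R : realType) (n : nat) :=
  GRing.isSubmodClosed.Build R 'M[R]_n (@symmetric_mx R n)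
    symmetric_mx_submod_closed.

Record symmx (R : realType) (n : nat) :=
  SymMx { symmx_val :> 'M[R]_n; symmxP : symmx_val \in symmetric_mx }.

HB.instance Definition _ (R : realType) (n : nat) :=
  [isSub for @symmx_val R n].
HB.instance Definition _ (R : realType) (n : nat) :=
  [Choice of symmx R n by <:].
HB.instance Definition _ (R : realType) (n : nat) :=
  [SubChoice_isSubLmodule of symmx R n by <:].

Section symmx_norm.
Variables (R : realType) (n : nat).
Implicit Types A B : symmx R n.

Definition symmx_norm A : R := `|symmx_val A|.

Lemma symmx_normD A B : symmx_norm (A + B) <= symmx_norm A + symmx_norm B.
Proof. exact: ler_normD. Qed.

Lemma symmx_normZ (a : R) A : symmx_norm (a *: A) = `|a| * symmx_norm A.
Proof. exact: normrZ. Qed.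

Lemma symmx_norm_eq0 A : symmx_norm A = 0 -> A = 0.
Proof. by move=> /normr0_eq0 A0; apply: val_inj. Qed.

(* The norm only fixes the usual topology of this finite-dimensional space;   *)
(* the trace inner product is written out explicitly where it is needed.      *)
HB.instance Definition _ :=
  Lmodule_isNormed.Build R (symmx R n) symmx_normD symmx_normZ symmx_norm_eq0.

End symmx_norm.

Definition posdef {R : realType} {n : nat} : set (symmx R n) :=
  [set X | forall u : 'cV[R]_n, u != 0 -> 0 < (u^T *m X *m u) 0 0].

Definition symp {R : realType} {n : nat} (A : 'M[R]_n) : 'M[R]_n :=
  2^-1 *: (A + A^T).

(* In finite dimension, continuity of [Y |-> 'd F Y U] for every [U] is       *)
(* continuity of the Frechet derivative in operator norm.  All these notions  *)
(* are meant for an open [D], so that only the values of [F] on [D] matter.   *)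
Definition C1_on {R : realType} {V W : normedModType R}
    (D : set V) (F : V -> W) : Prop :=
  forall X, D X ->
    differentiable F X /\ forall U, {for X, continuous (fun Y => 'd F Y U)}.

Definition C2_on {R : realType} {V W : normedModType R}
    (D : set V) (F : V -> W) : Prop :=
  C1_on D F /\ forall U, C1_on D (fun Y => 'd F Y U).

Section open_manifold.
Context {R : realType} {V : normedModType R}.
(* [D] is an open subset of [V], seen as a manifold whose tangent space at    *)
(* each point is [V]; a vector field is a map [V -> V] considered on [D], and *)
(* [g X] is the metric at [X].                                                *)
Variables (D : set V) (g : V -> V -> V -> R).
Implicit Types (nabla : V -> V -> (V -> V) -> V) (S T : V -> V).

(* [nabla X U T] stands for the covariant derivative at [X] of the field [T]  *)
(* along the tangent vector [U].  Connections act on C^1 fields, and not just *)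
(* on smooth ones, because the gradient of a C^2 function is only C^1.        *)
Record affine_connection nabla : Prop := AffineConnection {
  connection_linear : forall T X a U1 U2, C1_on D T -> D X ->
    nabla X (a *: U1 + U2) T = a *: nabla X U1 T + nabla X U2 T ;
  connection_add : forall S T X U, C1_on D S -> C1_on D T -> D X ->
    nabla X U (fun Y => S Y + T Y) = nabla X U S + nabla X U T ;
  connection_leibniz : forall (h : V -> R) T X U,
    C1_on D h -> C1_on D T -> D X ->
    nabla X U (fun Y => h Y *: T Y) = 'd h X U *: T X + h X *: nabla X U T ;
  connection_continuous : forall T X U, C1_on D T -> D X ->
    {for X, continuous (fun Y => nabla Y U T)}
}.

(* The Lie bracket of [S] and [T] at [X] is ['d T X (S X) - 'd S X (T X)].    *)
Definition torsion_free nabla : Prop :=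
  forall S T X, C1_on D S -> C1_on D T -> D X ->
    nabla X (S X) T - nabla X (T X) S = 'd T X (S X) - 'd S X (T X).

Definition metric_compatible nabla : Prop :=
  forall S T X U, C1_on D S -> C1_on D T -> D X ->
    'd (fun Y => g Y (S Y) (T Y)) X U =
    g X (nabla X U S) (T X) + g X (S X) (nabla X U T).

Definition is_levi_civita nabla : Prop :=
  [/\ affine_connection nabla, torsion_free nabla & metric_compatible nabla].

(* The definite descriptions below are rendered by [xget], whose value is 0   *)
(* when no object with the defining property exists.  For a nondegenerate     *)
(* metric on an open [D], two Levi-Civita connections agree on [C1_on D]      *)
(* fields at points of [D].                                                   *)
Definition levi_civita : V -> V -> (V -> V) -> V :=
  xget (fun _ _ _ => 0) [set nabla | is_levi_civita nabla].

Definition rgrad (f : V -> R) (X : V) : V :=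
  xget 0 [set G | forall U, g X G U = 'd f X U].

Definition rhess (f : V -> R) (X U : V) : V := levi_civita X U (rgrad f).

End open_manifold.

Section gbw.
Context {R : realType} {n : nat}.
Implicit Types (X M U : symmx R n) (f : symmx R n -> R).

Definition lyap X M U : 'M[R]_n :=
  xget 0 [set L : 'M[R]_n | X *m L *m M + M *m L *m X = U].

Definition gbw M X U1 U2 : R := 2^-1 * \tr (lyap X M U1 *m U2).

Definition egrad f X : symmx R n :=
  xget 0 [set G : symmx R n | forall U, \tr (G *m U) = 'd f X U].

Definition ehess f X U : symmx R n := 'd (egrad f) X U.

Definition gbw_grad M f X : symmx R n := rgrad (gbw M) f X.

Definition gbw_hess M f X U : symmx R n := rhess posdef (gbw M) f X U.

End gbw.

(* Main.v *)
Require Import Defs.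
From HB Require Import structures.
From mathcomp Require Import all_boot all_order all_algebra.
From mathcomp Require Import ring lra.
From mathcomp Require Import all_classical all_reals all_analysis.
Import Order.TTheory GRing.Theory Num.Theory.
Import numFieldNormedType.Exports.
Local Open Scope classical_set_scope.
Local Open Scope ring_scope.

Set Implicit Arguments.
Unset Strict Implicit.
Unset Printing Implicit Defensive.

(* The generalized Bures-Wasserstein metric is handled through the            *)
(* Lyapunov operator L |-> X L M + M L X, which is self-adjoint for the       *)
(* trace form and, by Cholesky factorization of X and M, positive             *)
(* definite.  Differentiating X L M + M L X = S(X) implicitly gives the       *)
(* derivative of the metric, hence Christoffel symbols                        *)
(*   Gamma(U, S) = 2 {X {L_U M L_S}_S M}_S - {M L_S U + M L_U S}_S            *)
(* with L_U the Lyapunov solution for U; D + Gamma is the Levi-Civita         *)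
(* connection.  Since the Lyapunov solution for grad f is twice the Euclidean *)
(* gradient, D (grad f) [U] + Gamma(U, grad f) is the claimed Hessian.        *)

(** Gradient and Levi-Civita connection are definite descriptions, so each formula needs existence
    and uniqueness. For the gradient, the Lyapunov solution of the claimed value is twice the
    Euclidean gradient, and the metric is nondegenerate ([gbw_gradE], [gbw_nondeg]). For the
    connection, [gbw_connection_levi_civita] exhibits D + Gamma: Gamma is symmetric, hence no
    torsion, and its contraction with the metric reproduces the derivative of the metric
    ([is_diff_gbw], [christoffel_metric]). By [levi_civita_unique] every other candidate agrees with
    it on C^1 fields, and by [gbw_grad_C1] the gradient is such a field. The analytic core is
    [is_diff_implicit], which differentiates the Lyapunov solution; the matrix identity [symp_hess]
    then gives the stated form. *)

Lemma cholesky (R : realType) (n : nat) (A : 'M[R]_n) :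
  A^T = A -> (forall u : 'cV[R]_n, u != 0 -> 0 < (u^T *m A *m u) 0 0) ->
  exists B : 'M[R]_n, A = B *m B^T.
Proof.
elim: n A => [|n IHn]; first by exists 0; rewrite [LHS]flatmx0 [RHS]flatmx0.
rewrite -[n.+1]/(1 + n)%N => A symA posA.
have [a [b [C [defA symC]]]] : exists (a : R) (b : 'cV[R]_n) (C : 'M[R]_n),
    A = block_mx a%:M b^T b C /\ C^T = C.
  exists (ulsubmx A 0 0), (dlsubmx A).
  exists (drsubmx A); split; last by rewrite trmx_drsub symA.
  by rewrite trmx_dlsub symA -mx11_scalar submxK.
pose u0 : 'cV[R]_(1 + n) := col_mx 1%:M 0.
have a_gt0 : 0 < a.
  have u0_neq0 : u0 != 0.
    by rewrite col_mx_eq0 negb_and -scalemx1 scale1r oner_eq0.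
  have := posA u0 u0_neq0.
  rewrite defA -mulmxA mul_block_col tr_col_mx mul_row_col.
  by rewrite !mulmx0 trmx0 mul0mx !addr0 trmx1 mul1mx mulmx1 mxE eqxx.
(* The Schur complement of the corner entry; the induction hypothesis factors it. *)
pose S := C - a^-1 *: (b *m b^T).
have symS : S^T = S by rewrite /S linearB linearZ /= trmx_mul trmxK symC.
have posS (v : 'cV[R]_n) : v != 0 -> 0 < (v^T *m S *m v) 0 0.
  (* This first coordinate minimizes the form of [A] for fixed [v]; the minimum is the form of [S]
     at [v]. *)
  move=> v_neq0; pose w : 'cV[R]_(1 + n) := col_mx (- a^-1 *: (b^T *m v)) v.
  have w_neq0 : w != 0 by rewrite col_mx_eq0 negb_and v_neq0 orbT.
  have := posA w w_neq0; rewrite defA -mulmxA mul_block_col tr_col_mx mul_row_col.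
  rewrite mul_scalar_mx scalerA mulrN divff ?gt_eqF// scaleN1r addNr mulmx0 add0r.
  rewrite -scalemxAr mulmxA scaleNr addrC -mulmxA.
  by rewrite -[v^T *m S *m v]mulmxA mulmxBl -scalemxAl -!mulmxA.
have [B defS] := IHn S symS posS.
pose s := Num.sqrt a; have s2 : s * s = a by rewrite -expr2 sqr_sqrtr ?ltW.
have s_neq0 : s != 0 by rewrite sqrtr_eq0 -ltNge.
exists (block_mx s%:M 0 (s^-1 *: b) B).
rewrite defA [in RHS]tr_block_mx mulmx_block; congr block_mx.
- by rewrite trmx0 mulmx0 addr0 tr_scalar_mx -scalar_mxM s2.
- rewrite mul0mx addr0 linearZ /= mul_scalar_mx scalerA divff//.
  by rewrite scale1r.
- by rewrite trmx0 mulmx0 addr0 tr_scalar_mx mul_mx_scalar scalerA divff// scale1r.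
- rewrite -defS linearZ /= -scalemxAl -scalemxAr scalerA -invfM s2.
  by rewrite /S addrC subrK.
Qed.

(** A nonzero row vector killed by the Cholesky factor would annihilate the quadratic form of
    [X]. *)
Lemma posdef_factor (R : realType) (n : nat) (X : symmx R n) :
  posdef X -> exists2 B : 'M[R]_n, B \in unitmx & (X : 'M[R]_n) = B *m B^T.
Proof.
move=> hX; have symX : (X : 'M[R]_n)^T = X by apply/eqP; exact: (symmxP X).
have [B defX] := cholesky symX hX; exists B => //.
rewrite -row_free_unit -kermx_eq0; apply/rowV0P => v /sub_kermxP vB.
apply/eqP; apply: contraT => v_neq0.
have /hX : v^T != 0 by rewrite trmx_eq0.
by rewrite trmxK defX mulmxA vB !mul0mx mxE ltxx.
Qed.

Lemma quad_sqr_sum (R : realType) (n : nat) (w : 'cV[R]_n) :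
  (w^T *m w) 0 0 = \sum_i w i 0 ^+ 2.
Proof. by rewrite mxE; apply: eq_bigr => i _; rewrite mxE. Qed.

(** Each coordinate of [w] is at most its Euclidean norm. This crude bound suffices for openness of
    the positive definite cone. *)
Lemma quad_bound (R : realType) (n : nat) (E : 'M[R]_n) (w : 'cV[R]_n) :
  `|(w^T *m E *m w) 0 0| <= (\sum_i \sum_j `|E i j|) * (w^T *m w) 0 0.
Proof.
have wle i : `|w i 0| <= Num.sqrt ((w^T *m w) 0 0).
  rewrite -sqrtr_sqr ler_wsqrtr// quad_sqr_sum (bigD1 i)//= lerDl.
  by apply: sumr_ge0 => j _; rewrite sqr_ge0.
rewrite -[X in _ * X](@sqr_sqrtr _ ((w^T *m w) 0 0)); last first.
  by rewrite quad_sqr_sum; apply: sumr_ge0 => i _; rewrite sqr_ge0.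
set r := Num.sqrt _ in wle *.
rewrite -mulmxA mxE mulr_suml (le_trans (ler_norm_sum _ _ _))//.
apply: ler_sum => i _; rewrite !mxE mulr_sumr mulr_suml.
rewrite (le_trans (ler_norm_sum _ _ _))//; apply: ler_sum => j _.
by rewrite !normrM mulrCA expr2 ler_wpM2l// ler_pM.
Qed.

Lemma mxtr_mul_trE (R : realType) (n : nat) (C : 'M[R]_n) :
  \tr (C *m C^T) = \sum_i \sum_j C i j ^+ 2.
Proof.
by apply: eq_bigr => i _; rewrite mxE; apply: eq_bigr => j _; rewrite mxE.
Qed.

Lemma mxtr_mul_tr_ge0 (R : realType) (n : nat) (C : 'M[R]_n) :
  0 <= \tr (C *m C^T).
Proof.
by rewrite mxtr_mul_trE; do 2![apply: sumr_ge0 => ? _]; rewrite sqr_ge0.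
Qed.

Lemma mxtr_mul_tr_eq0 (R : realType) (n : nat) (C : 'M[R]_n) :
  \tr (C *m C^T) = 0 -> C = 0.
Proof.
rewrite mxtr_mul_trE => /psumr_eq0P C0; apply/matrixP => i j; rewrite mxE.
have /psumr_eq0P Ci0 : \sum_j C i j ^+ 2 = 0.
  by apply: C0 => // k _; apply: sumr_ge0 => l _; rewrite sqr_ge0.
by apply/eqP; rewrite -sqrf_eq0 Ci0// => k _; rewrite sqr_ge0.
Qed.

(** * The Lyapunov operator and its inverse *)

(** With X = A A^T and M = B B^T, the trace pairing of the left-hand side with L is the sum of the
    squared Frobenius norms of A^T L B and B^T L A. Both vanish, and A and B are invertible. *)
Lemma lyap_op_eq0 (R : realType) (n : nat) (X M : symmx R n) (L : 'M[R]_n) :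
  posdef X -> posdef M -> X *m L *m M + M *m L *m X = 0 -> L = 0.
Proof.
move=> /posdef_factor[A uA defX] /posdef_factor[B uB defM] eqL.
have : \tr ((A^T *m L *m B) *m (A^T *m L *m B)^T) = 0.
  have : \tr (X *m L *m M *m L^T) + \tr (M *m L *m X *m L^T) = 0.
    by rewrite -linearD /= -mulmxDl eqL mul0mx linear0.
  have -> : \tr (X *m L *m M *m L^T) = \tr ((A^T *m L *m B) *m (A^T *m L *m B)^T).
    rewrite !trmx_mul trmxK defX defM !mulmxA -!mulmxA mxtrace_mulC.
    by rewrite !mulmxA.
  have -> : \tr (M *m L *m X *m L^T) = \tr ((B^T *m L *m A) *m (B^T *m L *m A)^T).
    rewrite !trmx_mul trmxK defX defM !mulmxA -!mulmxA mxtrace_mulC.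
    by rewrite !mulmxA.
  by move/eqP; rewrite paddr_eq0 ?mxtr_mul_tr_ge0// => /andP[/eqP].
move/mxtr_mul_tr_eq0.
move/(congr1 (fun C => C *m invmx B)); rewrite mulmxK// mul0mx.
move/(congr1 (mulmx (invmx A^T))); rewrite mulKmx ?unitmx_tr//.
by rewrite mulmx0.
Qed.

Lemma symmxE (R : realType) (n : nat) (X : symmx R n) : (X : 'M[R]_n)^T = X.
Proof. exact/eqP/(symmxP X). Qed.

Section lyapunov_operator.
Variables (R : realType) (n : nat) (M : symmx R n).
Hypothesis M_posdef : posdef M.
Implicit Types (X : symmx R n) (L : 'M[R]_n).

Definition lyap_op X L := X *m L *m M + M *m L *m X.

Lemma lyap_op_linear X : linear (lyap_op X).
Proof.
move=> a L1 L2; rewrite /lyap_op scalerDr !mulmxDr !mulmxDl.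
by rewrite -!scalemxAr -!scalemxAl addrACA.
Qed.

HB.instance Definition _ X :=
  GRing.isLinear.Build R 'M[R]_n 'M[R]_n _ (lyap_op X) (lyap_op_linear X).

Lemma tr_lyap_op X L : (lyap_op X L)^T = lyap_op X L^T.
Proof. by rewrite /lyap_op linearD /= !trmx_mul !symmxE !mulmxA addrC. Qed.

Lemma lyap_op_injective X : posdef X -> injective (lyap_op X).
Proof.
move=> hX L1 L2 /eqP; rewrite -subr_eq0 -linearB => /eqP eqL.
by apply/eqP; rewrite -subr_eq0; apply/eqP/(lyap_op_eq0 hX M_posdef eqL).
Qed.

(** A total inverse, linear at every [X] and defined on all matrices, so that it can carry a linear
    structure; it is a genuine inverse at positive definite [X]. *)
Definition lyap_inv X (U : 'M[R]_n) : 'M[R]_n := (linfun (lyap_op X))^-1%VF U.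

Lemma lyap_inv_linear X : linear (lyap_inv X).
Proof. by move=> a U1 U2; rewrite /lyap_inv linearP. Qed.

HB.instance Definition _ X :=
  GRing.isLinear.Build R 'M[R]_n 'M[R]_n _ (lyap_inv X) (lyap_inv_linear X).

Lemma lyap_op_lker X : posdef X -> lker (linfun (lyap_op X)) == 0%VS.
Proof.
by move=> hX; apply/lker0P => L1 L2; rewrite !lfunE; exact: lyap_op_injective.
Qed.

Lemma lyap_invK X : posdef X -> cancel (lyap_inv X) (lyap_op X).
Proof.
by move=> hX U; rewrite -[RHS](lker0_lfunVK (lyap_op_lker hX)) lfunE.
Qed.

Lemma lyap_opK X : posdef X -> cancel (lyap_op X) (lyap_inv X).
Proof.
by move=> hX L; rewrite -[RHS](lker0_lfunK (lyap_op_lker hX)) lfunE.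
Qed.

Lemma lyapP X (U : symmx R n) : posdef X -> lyap_op X (lyap X M U) = U.
Proof.
move=> hX; rewrite /lyap.
apply: (@xgetPex _ 0 [set L | X *m L *m M + M *m L *m X = U]).
by exists (lyap_inv X U); exact: lyap_invK.
Qed.

Lemma lyap_unique X (U : symmx R n) L :
  posdef X -> lyap_op X L = U -> lyap X M U = L.
Proof. by move=> hX defU; apply: (lyap_op_injective hX); rewrite lyapP. Qed.

(** The transpose solves the same equation, and the solution is unique. *)
Lemma tr_lyap X (U : symmx R n) : posdef X -> (lyap X M U)^T = lyap X M U.
Proof.
move=> hX; apply/esym/lyap_unique => //.
by rewrite -tr_lyap_op lyapP// symmxE.
Qed.

Lemma lyap_linear X : posdef X -> linear (lyap X M).
Proof.
move=> hX a U1 U2; apply: lyap_unique => //.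
by rewrite linearP /= !lyapP.
Qed.

Lemma lyapE X (U : symmx R n) : posdef X -> lyap X M U = lyap_inv X U.
Proof. by move=> hX; apply: lyap_unique => //; exact: lyap_invK. Qed.

(** Cyclicity of the trace exchanges the two summands of the operator. *)
Lemma mxtr_lyap_op X (L1 L2 : 'M[R]_n) :
  \tr (L1 *m lyap_op X L2) = \tr (lyap_op X L1 *m L2).
Proof.
rewrite /lyap_op mulmxDr mulmxDl !mxtraceD addrC; congr (_ + _).
  by rewrite !mulmxA mxtrace_mulC !mulmxA.
by rewrite !mulmxA mxtrace_mulC !mulmxA.
Qed.

End lyapunov_operator.

(** * Continuity and differentiation of matrix expressions *)

Lemma continuous_sum (R : realType) (T : topologicalType) (V : normedModType R)
  (I : Type) (r : seq I) (F : I -> T -> V) (x : T) :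
  (forall i, {for x, continuous (F i)}) ->
  {for x, continuous (fun y => \sum_(i <- r) F i y)}.
Proof.
move=> Fc; apply: cvg_big => [|i _]; first exact: add_continuous.
exact: Fc.
Qed.

Lemma mx_linear_continuous (R : realType) (W : normedModType R) (m n : nat)
  (F : {linear 'M[R]_(m, n) -> W}) : continuous F.
Proof.
have -> : (F : _ -> _) = fun A => \sum_i \sum_j A i j *: F (delta_mx i j).
  apply/funext => A; rewrite {1}(matrix_sum_delta A) linear_sum.
  apply: eq_bigr => i _; rewrite linear_sum.
  by apply: eq_bigr => j _; rewrite linearZ.
move=> A; apply: continuous_sum => i; apply: continuous_sum => j.
apply: (@cvgZr_tmp _ _ _ (nbhs A) _ (fun B : 'M[R]_(m, n) => B i j)).
exact: coord_continuous.
Qed.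

Lemma mulmx_bilinear (R : realType) (m n p : nat) :
  bilinear_for
    (GRing.Scale.Law.clone _ _ *:%R _) (GRing.Scale.Law.clone _ _ *:%R _)
    (@mulmx R m n p).
Proof.
split=> [A|B] a C D /=; first by rewrite mulmxDl scalemxAl.
by rewrite mulmxDr scalemxAr.
Qed.

HB.instance Definition _ (R : realType) (m n p : nat) :=
  bilinear_isBilinear.Build R _ _ _ _ _ (@mulmx R m n p) (mulmx_bilinear R m n p).

Lemma mulmx_continuous (R : realType) (m n p : nat) :
  continuous (fun q : 'M[R]_(m, n) * 'M[R]_(n, p) => q.1 *m q.2).
Proof.
have -> : (fun q : 'M[R]_(m, n) * 'M[R]_(n, p) => q.1 *m q.2) =
    fun q => \sum_i \sum_j (\sum_k q.1 i k * q.2 k j) *: delta_mx i j.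
  apply/funext => q; rewrite {1}(matrix_sum_delta (q.1 *m q.2)).
  by apply: eq_bigr => i _; apply: eq_bigr => j _; rewrite mxE.
move=> q; apply: continuous_sum => i; apply: continuous_sum => j.
apply: (@cvgZr_tmp _ _ _ (nbhs q)).
apply: (@continuous_sum _ _ R^o) => k.
apply: (@cvgM _ _ (nbhs q) _ (fun q => q.1 i k) (fun q => q.2 k j)).
  by apply: (cvg_comp _ (fun C : 'M[R]_(m, n) => C i k) cvg_fst);
    exact: coord_continuous.
by apply: (cvg_comp _ (fun C : 'M[R]_(n, p) => C k j) cvg_snd);
  exact: coord_continuous.
Qed.

Lemma continuous_mulmx (R : realType) (T : topologicalType) (m n p : nat)
  (f : T -> 'M[R]_(m, n)) (g : T -> 'M[R]_(n, p)) (x : T) :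
  {for x, continuous f} -> {for x, continuous g} ->
  {for x, continuous (fun y => f y *m g y)}.
Proof.
move=> fc gc.
apply: (@continuous2_cvg _ _ _ _ (nbhs x) _ f g mulmx _ _ _ fc gc).
exact: (@mulmx_continuous R m n p (f x, g x)).
Qed.

(** An instance, like the ones below, so that class resolution differentiates composite matrix
    expressions. *)
#[global] Instance is_diff_mulmx (R : realType) (V : normedModType R) (m n p : nat)
  (f df : V -> 'M[R]_(m, n)) (g dg : V -> 'M[R]_(n, p)) (x : V) :
  is_diff x f df -> is_diff x g dg ->
  is_diff x (fun y => f y *m g y) (fun h => f x *m dg h + df h *m g x).
Proof.
move=> dfx dgx; pose mul q := (q.1 : 'M[R]_(m, n)) *m (q.2 : 'M[R]_(n, p)).
have dmul : is_diff (f x, g x) mul (fun q => f x *m q.2 + q.1 *m g x).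
  apply: DiffDef; first exact: (differentiable_bilin _ (@mulmx_continuous _ _ _ _)).
  exact: (diff_bilin _ (@mulmx_continuous _ _ _ _)).
exact: (is_diff_comp (is_diff_pair dfx dgx) dmul).
Qed.

#[global] Instance is_diff_linear_comp (R : realType) (V W Z : normedModType R)
  (F : {linear W -> Z}) (f df : V -> W) (x : V) : continuous F ->
  is_diff x f df -> is_diff x (fun y => F (f y)) (fun h => F (df h)).
Proof.
move=> Fc dfx.
have dF : is_diff (f x) F F.
  by apply: DiffDef; [exact: linear_differentiable|exact: diff_lin].
exact: is_diff_comp dfx dF.
Qed.

Lemma is_diff_sum (R : realType) (V W : normedModType R) (I : Type)
  (r : seq I) (f df : I -> V -> W) (x : V) :
  (forall i, is_diff x (f i) (df i)) ->
  is_diff x (fun y => \sum_(i <- r) f i y) (fun h => \sum_(i <- r) df i h).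
Proof.
move=> dfi; elim: r => [|i r IHr].
  have -> : (fun y => \sum_(i <- [::]) f i y) = cst 0.
    by apply/funext => y; rewrite big_nil.
  by apply: is_diff_eq; apply/funext => h; rewrite big_nil.
have -> : (fun y => \sum_(j <- i :: r) f j y) =
    f i + (fun y => \sum_(j <- r) f j y).
  by apply/funext => y; rewrite big_cons.
by apply: is_diff_eq; apply/funext => h; rewrite big_cons.
Qed.

Lemma is_diff_scalel_fun (R : realType) (V W : normedModType R)
  (h dh : V -> R) (w : W) (x : V) : is_diff x h dh ->
  is_diff x (fun y => h y *: w) (fun u => dh u *: w).
Proof. by move=> dhx; exact: (is_diff_comp dhx (is_diff_scalel _ w)). Qed.

(** * Differentials from local estimates, and implicit differentiation *)

Section differential_near.
Variables (R : realType) (V W : normedModType R).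

Lemma is_diff_near (f : V -> W) (df : {linear V -> W}) (x : V) :
  continuous df ->
  (forall e, 0 < e ->
    \forall y \near x, `|f y - f x - df (y - x)| <= e * `|y - x|) ->
  is_diff x f df.
Proof.
move=> dfc fx.
have fdf : f \o shift x = cst (f x) + df +o_ 0 id.
  apply/eqaddoE; apply/eqaddoP => e e0.
  have := fx e e0; rewrite (near_shift 0) subr0; apply: filterS => h /=.
  by rewrite addrK !fctE /= opprD addrA.
have d := diff_unique dfc fdf.
apply: DiffDef; last by rewrite d.
by apply/diff_locallyP; rewrite d.
Qed.

Lemma differentiable_near (f : V -> W) (x : V) : differentiable f x ->
  forall e, 0 < e ->
    \forall y \near x, `|f y - f x - 'd f x (y - x)| <= e * `|y - x|.
Proof.
move=> /diff_locally fdf e e0.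
rewrite (near_shift 0) subr0; move/eqaddoE/eqaddoP: fdf => /(_ e e0).
by apply: filterS => h /=; rewrite addrK !fctE /= opprD addrA.
Qed.

(** Differentials depend on germs only. The closed forms used later are available only on the
    positive definite cone. *)
Lemma is_diff_near_eq (f g df : V -> W) (x : V) :
  (\forall y \near x, f y = g y) -> is_diff x g df -> is_diff x f df.
Proof.
move=> fg dg; have gx := @ex_diff _ _ _ _ _ _ _ dg.
rewrite -(@diff_val _ _ _ _ _ _ _ dg).
apply: is_diff_near; first exact: diff_continuous.
move=> e e0; have := differentiable_near gx e0.
have -> : g x = f x by rewrite (nbhs_singleton fg).
by apply: filterS2 fg => y ->.
Qed.

End differential_near.

Section implicit.
Variables (R : realType) (V W Z : normedModType R).
Variables (Q : {bilinear V -> W -> Z}) (K : {linear Z -> W}).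
Hypothesis Q_continuous : continuous (fun q => Q q.1 q.2).
Hypothesis K_continuous : continuous K.

(** Replacing [L y] by [L x] costs at most a constant times [|y - x|] [|L y - L x|], which is
    o([|y - x|]) by mere continuity of [L] at [x]. *)
Lemma is_diff_vanishing_bilin (x : V) (L : V -> W) : {for x, continuous L} ->
  is_diff x (fun y => Q (y - x) (L y)) (fun h => Q h (L x)).
Proof.
move=> Lc; have [k k0 Qk] := bilinear_schwarz Q_continuous.
have lind : linear (fun h => Q h (L x)) by move=> a u v; rewrite linearPl.
pose dlM := GRing.isLinear.Build _ _ _ _ _ lind.
pose dL : {linear V -> Z} := HB.pack (fun h => Q h (L x)) dlM.
apply: (@is_diff_near _ _ _ _ dL) => [|e e0].
  apply: (linear_bounded_continuous dL).1; apply/linear_boundedP.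
  exists (k * `|L x|); split; first exact: num_real.
  by move=> r /ltW rk v; rewrite /= (le_trans (Qk _ _))// mulrAC ler_wpM2r.
have : \forall y \near x, `|L x - L y| <= k^-1 * e.
  by apply: cvgr_dist_le => //; rewrite mulr_gt0// invr_gt0.
apply: filterS => y yL.
rewrite /= subrr linear0l subr0 -linearBr (le_trans (Qk _ _))//.
by rewrite mulrAC ler_wpM2r// -ler_pdivlMl// distrC.
Qed.

(* [L y = K (S y - Q (y - x) (L y))] near [x], where the last term is         *)
(* differentiable at [x] as soon as [L] is continuous there.                  *)
Lemma is_diff_implicit (x : V) (L : V -> W) (S dS : V -> Z) :
  cancel (Q x) K -> (\forall y \near x, Q y (L y) = S y) -> is_diff x S dS ->
  is_diff x L (fun h => K (dS h - Q h (L x))).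
Proof.
move=> QK QLS diffS.
have Sc : {for x, continuous S} by exact: differentiable_continuous.
have LE : \forall y \near x, L y = K (S y - Q (y - x) (L y)).
  by apply: filterS QLS => y <-; rewrite linearBl subKr QK.
suff Lc : {for x, continuous L}.
  apply: is_diff_near_eq LE _.
  have dQ := is_diff_vanishing_bilin Lc.
  exact: is_diff_linear_comp.
have [k k0 Qk] := bilinear_schwarz Q_continuous.
have [c c0 Kc] : exists2 c, 0 < c & forall z, `|K z| <= c * `|z|.
  exact: linear_lipschitz.
have c_ck : 0 < c * k by rewrite mulr_gt0.
(* Continuity of [L] starts from local boundedness: once c k |y - x| <= 1/2, the term in |L y| on
   the right of the fixed-point equation is absorbed on the left, whence the factor 2. *)
pose b := 2 * (c * (`|S x| + 1)).
have L_bounded : \forall y \near x, `|L y| <= b.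
  have S_bounded : \forall y \near x, `|S x - S y| <= 1.
    exact: cvgr_dist_le.
  have yx_small : \forall y \near x, `|x - y| <= (2 * (c * k))^-1.
    by apply: cvgr_dist_le => //; rewrite invr_gt0 mulr_gt0.
  near=> y.
  have Ly : `|L y| <= c * (`|S y| + k * `|y - x| * `|L y|).
    have {1}-> : L y = K (S y - Q (y - x) (L y)) by near: y.
    by rewrite (le_trans (Kc _))// ler_pM2l// (le_trans (ler_normB _ _))// lerD2l.
  have Sy : `|S y| <= `|S x| + 1.
    rewrite -lerBlDl (le_trans _ (_ : `|S x - S y| <= 1))//; last by near: y.
    by rewrite distrC lerB_dist.
  have yx : c * k * `|y - x| <= 2^-1.
    have yx : `|x - y| <= (2 * (c * k))^-1 by near: y.
    by rewrite -ler_pdivlMl// -invfM distrC [c * k * 2]mulrC.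
  have := ler_wpM2r (normr_ge0 (L y)) yx; have := ler_wpM2l (ltW c0) Sy.
  by move: Ly; rewrite /b !mulrDr !mulrA; lra.
have b0 : 0 < b by rewrite !mulr_gt0// ltr_wpDl.
apply/cvgrPdist_le => e e0.
(* After applying [K], the variation of [S] and the bilinear term, with [L y] bounded by [b],
   contribute e/2 each. *)
have S_close : \forall y \near x, `|S x - S y| <= e / (2 * c).
  by apply: cvgr_dist_le => //; rewrite divr_gt0// mulr_gt0.
have yx_small : \forall y \near x, `|x - y| <= e / (2 * (c * k * b)).
  by apply: cvgr_dist_le => //; rewrite divr_gt0// !mulr_gt0.
near=> y.
have -> : L x = K (S x) by rewrite -[in RHS](nbhs_singleton QLS) QK.
have -> : L y = K (S y - Q (y - x) (L y)) by near: y.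
rewrite -linearB opprB addrCA addrC (le_trans (Kc _))//.
have Sy : `|S x - S y| <= e / (2 * c) by near: y.
have yx : `|y - x| <= e / (2 * (c * k * b)) by rewrite distrC; near: y.
have Ly : `|L y| <= b by near: y.
have Qy : `|Q (y - x) (L y)| <= e / (2 * c).
  rewrite (le_trans (Qk _ _))// -mulrA.
  have -> : e / (2 * c) = k * (e / (2 * (c * k * b)) * b).
    by field; rewrite !gt_eqF.
  by rewrite ler_pM2l// ler_pM.
have -> : e = c * (e / (2 * c) + e / (2 * c)) by field; rewrite gt_eqF.
by rewrite ler_pM2l// (le_trans (ler_normD _ _))// lerD.
Unshelve. all: by end_near. Qed.

End implicit.

(** * Symmetric matrices and openness of the positive definite cone *)

Section symmetric_matrices.
Variables (R : realType) (n : nat).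
Implicit Types (X : symmx R n) (A L : 'M[R]_n).

Lemma symmx_val_linear : linear (@symmx_val R n).
Proof. by []. Qed.

HB.instance Definition _ :=
  GRing.isLinear.Build R (symmx R n) 'M[R]_n _ (@symmx_val R n) symmx_val_linear.

Lemma symmx_val_continuous : continuous (@symmx_val R n).
Proof.
apply: (linear_bounded_continuous (@symmx_val R n)).1; apply/linear_boundedP.
exists 1; split; first exact: num_real.
by move=> r /ltW r1 X; rewrite -[leLHS]mul1r ler_wpM2r.
Qed.

Lemma symp_linear : linear (@symp R n).
Proof.
move=> a A B; rewrite /symp linearP /= addrACA -scalerDr [LHS]scalerDr.
by rewrite !scalerA mulrC.
Qed.

HB.instance Definition _ :=
  GRing.isLinear.Build R 'M[R]_n 'M[R]_n _ (@symp R n) symp_linear.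

Lemma symp_tr A : symp A^T = symp A.
Proof. by rewrite /symp trmxK addrC. Qed.

Lemma tr_symp A : (symp A)^T = symp A.
Proof. by rewrite /symp linearZ linearD /= trmxK addrC. Qed.

Lemma symp_id A : A^T = A -> symp A = A.
Proof.
by move=> symA; rewrite /symp symA; apply/matrixP => i j; rewrite !mxE; field.
Qed.

(** The antisymmetric part of [A] is trace-orthogonal to symmetric matrices. *)
Lemma mxtr_symp A L : L^T = L -> \tr (symp A *m L) = \tr (A *m L).
Proof.
move=> symL; rewrite /symp -scalemxAl mxtraceZ mulmxDl mxtraceD.
rewrite -[\tr (A^T *m L)]mxtrace_tr trmx_mul trmxK symL [\tr (L *m A)]mxtrace_mulC.
by lra.
Qed.

Definition sym_part A : symmx R n :=
  SymMx (introT eqP (tr_symp A) : symp A \in symmetric_mx).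

Lemma sym_part_linear : linear sym_part.
Proof. by move=> a A B; apply/val_inj; rewrite /= linearP. Qed.

HB.instance Definition _ :=
  GRing.isLinear.Build R 'M[R]_n (symmx R n) _ sym_part sym_part_linear.

Lemma sym_partK X : sym_part X = X.
Proof. by apply/val_inj/symp_id/symmxE. Qed.

#[global] Instance is_diff_symmx_val (V : normedModType R)
  (f df : V -> symmx R n) (x : V) : is_diff x f df ->
  is_diff x (fun y => symmx_val (f y)) (fun h => symmx_val (df h)).
Proof. exact/is_diff_linear_comp/symmx_val_continuous. Qed.

#[global] Instance is_diff_sym_part (V : normedModType R)
  (f df : V -> 'M[R]_n) (x : V) : is_diff x f df ->
  is_diff x (fun y => sym_part (f y)) (fun h => sym_part (df h)).
Proof. exact/is_diff_linear_comp/mx_linear_continuous. Qed.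

#[global] Instance is_diff_symp (V : normedModType R)
  (f df : V -> 'M[R]_n) (x : V) : is_diff x f df ->
  is_diff x (fun y => symp (f y)) (fun h => symp (df h)).
Proof. exact/is_diff_linear_comp/mx_linear_continuous. Qed.

Lemma is_diff_mxtrace (V : normedModType R)
  (f df : V -> 'M[R]_n) (x : V) : is_diff x f df ->
  is_diff x (fun y => \tr (f y)) (fun h => \tr (df h)).
Proof. exact/(is_diff_linear_comp (F := @mxtrace R n))/mx_linear_continuous. Qed.

(** Congruence by the inverse Cholesky factor of X turns X into the identity and Y into 1 + E(Y).
    The latter is positive definite once the absolute entries of E(Y) sum to less than 1. *)
Lemma posdef_near X : posdef X -> \forall Y \near X, posdef Y.
Proof.
move=> hX; have [B uB defX] := posdef_factor hX.
pose C := (invmx B)^T.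
pose E (Y : symmx R n) := C^T *m (Y - X) *m C.
have Ec : continuous E by move=> Y; apply: differentiable_continuous.
have Sc : continuous (fun Y => \sum_i \sum_j `|E Y i j| : R^o).
  move=> Y; apply: continuous_sum => i; apply: continuous_sum => j.
  apply: (@cvg_norm _ _ _ (nbhs Y)).
  by apply: (cvg_comp _ (fun C : 'M[R]_n => C i j) (Ec Y));
    exact: coord_continuous.
have : \forall Y \near X, (\sum_i \sum_j `|E Y i j|) < 1.
  apply: cvgr_lt (Sc X) _ _; rewrite big1 ?ltr01// => i _; rewrite big1// => j _.
  by rewrite /E subrr mulmx0 mul0mx mxE normr0.
apply: filterS => Y EY u u_neq0.
pose w := B^T *m u.
have uE : u = C *m w.
  by rewrite /w /C mulmxA -trmx_mul mulmxV// trmx1 mul1mx.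
have w_neq0 : w != 0 by apply: contra_neq u_neq0 => w0; rewrite uE w0 mulmx0.
have ww_gt0 : 0 < (w^T *m w) 0 0.
  rewrite quad_sqr_sum lt_neqAle sumr_ge0 ?andbT; last first.
    by move=> i _; exact: sqr_ge0.
  apply: contra_neq w_neq0 => /esym/psumr_eq0P w0; apply/colP => i.
  rewrite [RHS]mxE.
  by apply/eqP; rewrite -sqrf_eq0 w0// => j _; exact: sqr_ge0.
have -> : (u^T *m Y *m u) 0 0 = (w^T *m w) 0 0 + (w^T *m E Y *m w) 0 0.
  have -> : w^T *m E Y *m w = u^T *m (Y - X) *m u.
    by rewrite [in RHS]uE [in RHS](trmx_mul C w) /E !mulmxA.
  have -> : w^T *m w = u^T *m X *m u.
    by rewrite defX /w trmx_mul trmxK !mulmxA.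
  have -> : u^T *m Y *m u = u^T *m X *m u + u^T *m (Y - X) *m u.
    by rewrite -mulmxDl -mulmxDr subrKC.
  by rewrite [LHS]mxE.
have := quad_bound (E Y) w; rewrite ler_norml => /andP[+ _].
have : (\sum_i \sum_j `|E Y i j|) * (w^T *m w) 0 0 < 1 * (w^T *m w) 0 0.
  by rewrite ltr_pM2r.
by rewrite mul1r; lra.
Qed.

End symmetric_matrices.

(** * C^1 fields *)

Lemma C1_on_cst (R : realType) (V W : normedModType R) (D : set V) (w : W) :
  C1_on D (cst w).
Proof.
move=> X _; split; first exact: differentiable_cst.
move=> U; have -> : (fun Y => 'd (cst w) Y U) = cst 0.
  by apply/funext => Y; rewrite diff_cst.
exact: cst_continuous.
Qed.

Lemma C1_on_is_diff (R : realType) (V W : normedModType R) (D : set V)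
  (F : V -> W) (dF : V -> V -> W) :
  (forall X, D X -> \forall Y \near X, D Y) ->
  (forall X, D X -> is_diff X F (dF X)) ->
  (forall X U, D X -> {for X, continuous (dF^~ U)}) -> C1_on D F.
Proof.
move=> D_open diffF dFc X DX; have dFX := diffF X DX.
split=> [|U]; first exact: ex_diff.
have dFE : \forall Y \near X, 'd F Y U = dF Y U.
  apply: filterS (D_open X DX) => Y /diffF dFY.
  by rewrite (@diff_val _ _ _ _ _ _ _ dFY).
have dFXE := nbhs_singleton dFE.
rewrite /prop_for /continuous_at dFXE.
apply: cvg_trans (dFc X U DX); apply: near_eq_cvg.
by apply: filterS dFE => Y ->.
Qed.

Lemma is_diff_scalar_mul (R : realType) (V : normedModType R) (n : nat)
  (h dh : V -> R) (T dT : V -> symmx R n) (X : V) :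
  is_diff X h dh -> is_diff X T dT ->
  is_diff X (fun Y => h Y *: T Y) (fun U => dh U *: T X + h X *: dT U).
Proof.
move=> dhX dTX.
(* Scaling is written as a product with a scalar matrix, so that the matrix product rule applies. *)
have scalE a (S : symmx R n) : sym_part (a *: 1%:M *m S) = a *: S.
  by rewrite -scalemxAl mul1mx -[RHS]sym_partK.
have -> : (fun Y => h Y *: T Y) =
    fun Y => sym_part ((h Y *: 1%:M) *m symmx_val (T Y)).
  by apply/funext => Y; rewrite scalE.
have dk : is_diff X (fun Y => h Y *: (1%:M : 'M[R]_n)) (fun U => dh U *: 1%:M).
  exact: (is_diff_comp dhX (is_diff_scalel _ (1%:M : 'M[R]_n))).
by apply: is_diff_eq; apply/funext => U; rewrite linearD/= !scalE addrC.
Qed.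

(** * Uniqueness of the Levi-Civita connection *)

Section levi_civita_unique.
Variables (R : realType) (V : normedModType R).
Variables (D : set V) (g : V -> V -> V -> R).
Hypothesis gB : forall X A B W, D X -> g X (A - B) W = g X A W - g X B W.
Hypothesis g_sym : forall X A B, D X -> g X A B = g X B A.
Hypothesis g_nondeg : forall X A, D X -> (forall W, g X A W = 0) -> A = 0.

(* The difference of the two connections gives a form [c] that is symmetric   *)
(* in its first two arguments (torsion) and skew in the last two (metric),    *)
(* hence zero.                                                                *)
Lemma levi_civita_unique (nabla1 nabla2 : V -> V -> (V -> V) -> V) :
  is_levi_civita D g nabla1 -> is_levi_civita D g nabla2 ->
  forall X U T0, D X -> C1_on D T0 -> nabla1 X U T0 = nabla2 X U T0.
Proof.
move=> [_ tf1 mc1] [_ tf2 mc2] X U T0 DX T1.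
pose c S T W := g X (nabla1 X (S X) T - nabla2 X (S X) T) (W X).
have c_sym (S T : V -> V) W : C1_on D S -> C1_on D T -> c S T W = c T S W.
  move=> S1 T1'; rewrite /c; congr (g X _ _).
  have := tf1 S T X S1 T1' DX; rewrite -(tf2 S T X S1 T1' DX) => /eqP.
  rewrite -subr_eq0 opprD opprK addrACA [- _ + _]addrC addr_eq0 opprB.
  by move/eqP.
have c_skew (S T W : V -> V) : C1_on D T -> C1_on D W -> c S T W = - c S W T.
  move=> T1' W1; apply/eqP; rewrite -addr_eq0 /c.
  have := mc1 T W X (S X) T1' W1 DX; rewrite (mc2 T W X (S X) T1' W1 DX) => /eqP.
  rewrite !gB// => /eqP mc.
  rewrite ![g X _ (T X)]g_sym//; apply/eqP; lra.
(* Tangent vectors are extended by constant fields. Three skew and three symmetric swaps,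
   alternating, then carry [c] to its own opposite. *)
apply/eqP; rewrite -subr_eq0; apply/eqP/(g_nondeg DX) => W.
have U1 : C1_on D (cst U) by exact: C1_on_cst.
have W1 : C1_on D (cst W) by exact: C1_on_cst.
suff : c (cst U) T0 (cst W) = - c (cst U) T0 (cst W) by rewrite /c /cst; lra.
rewrite {1}c_skew// (c_sym (cst U) (cst W))// (c_skew (cst W))// opprK.
by rewrite (c_sym (cst W) T0)// (c_skew T0)// (c_sym T0 (cst U)).
Qed.

End levi_civita_unique.

(** * The metric, its derivative and its connection *)

Section gbw_metric.
Variables (R : realType) (n : nat) (M : symmx R n).
Hypothesis M_posdef : posdef M.
Implicit Types (X Y S T U : symmx R n) (L : 'M[R]_n).

Lemma lyap_op_bilinear :
  bilinear_for
    (GRing.Scale.Law.clone _ _ *:%R _) (GRing.Scale.Law.clone _ _ *:%R _)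
    (lyap_op M : symmx R n -> 'M[R]_n -> 'M[R]_n).
Proof.
split=> [L|X] a A B /=; last exact: linearP.
rewrite /lyap_op /= !mulmxDl !mulmxDr -!scalemxAl -!scalemxAr scalerDr.
by rewrite addrACA.
Qed.

HB.instance Definition _ :=
  bilinear_isBilinear.Build R _ _ _ _ _
    (lyap_op M : symmx R n -> 'M[R]_n -> 'M[R]_n) lyap_op_bilinear.

Lemma lyap_op_continuous :
  continuous (fun q : symmx R n * 'M[R]_n => lyap_op M q.1 q.2).
Proof.
have vc : continuous (fun q : symmx R n * 'M[R]_n => symmx_val q.1).
  by move=> q; apply: (cvg_comp _ _ cvg_fst); exact: symmx_val_continuous.
have sc : continuous (fun q : symmx R n * 'M[R]_n => q.2).
  by move=> q; exact: cvg_snd.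
have Mc : continuous (fun _ : symmx R n * 'M[R]_n => symmx_val M).
  exact: cst_continuous.
move=> q; apply: (@cvgD _ _ _ (nbhs q)).
  exact: (continuous_mulmx (continuous_mulmx (vc q) (sc q)) (Mc q)).
exact: (continuous_mulmx (continuous_mulmx (Mc q) (sc q)) (vc q)).
Qed.

(** Implicit differentiation of the Lyapunov equation, which holds in a neighbourhood of [X] by
    openness of the cone. *)
Lemma is_diff_lyap (S dS : symmx R n -> symmx R n) X : posdef X ->
  is_diff X S dS ->
  is_diff X (fun Y => lyap Y M (S Y))
    (fun h => lyap_inv M X (symmx_val (dS h) - lyap_op M h (lyap X M (S X)))).
Proof.
move=> hX dSX.
have near_lyap : \forall Y \near X, lyap_op M Y (lyap Y M (S Y)) = S Y.
  by apply: filterS (posdef_near hX) => Y hY; exact: lyapP.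
have dvS := is_diff_symmx_val dSX.
exact: (@is_diff_implicit _ _ _ _ (lyap_op M) (lyap_inv M X) lyap_op_continuous
  (@mx_linear_continuous _ _ _ _ (lyap_inv M X)) X (fun Y => lyap Y M (S Y)) _ _
  (lyap_opK M_posdef hX) near_lyap dvS).
Qed.

Lemma gbwE X S T : gbw M X S T = 2^-1 * \tr (lyap X M S *m T).
Proof. by []. Qed.

Lemma gbw_sym X S T : posdef X -> gbw M X S T = gbw M X T S.
Proof.
move=> hX; rewrite !gbwE -(lyapP M_posdef T hX).
by rewrite mxtr_lyap_op lyapP// mxtrace_mulC.
Qed.

Lemma gbwBl X S T U : posdef X -> gbw M X (S - T) U = gbw M X S U - gbw M X T U.
Proof.
move=> hX; rewrite !gbwE !lyapE// (linearB (@symmx_val R n)) linearB/=.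
by rewrite mulmxBl linearB/= mulrBr.
Qed.

Lemma gbwDl X S T U : posdef X -> gbw M X (S + T) U = gbw M X S U + gbw M X T U.
Proof.
move=> hX; rewrite !gbwE !lyapE// (linearD (@symmx_val R n)) linearD/= mulmxDl.
by rewrite linearD/= mulrDr.
Qed.

Lemma gbwDr X S T U : posdef X -> gbw M X S (T + U) = gbw M X S T + gbw M X S U.
Proof. by move=> hX; rewrite gbw_sym// gbwDl// ![gbw _ _ _ S]gbw_sym. Qed.

Lemma gbw_nondeg X S : posdef X -> (forall T, gbw M X S T = 0) -> S = 0.
Proof.
move=> hX gS0; apply/val_inj; rewrite -[LHS](lyapP M_posdef S hX).
suff -> : lyap X M S = 0 by rewrite linear0.
(* Testing against the Lyapunov solution L itself gives tr(L L) = 0 with L symmetric. *)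
have := gS0 (sym_part (lyap X M S)).
rewrite gbwE => /eqP; rewrite mulf_eq0 invr_eq0 pnatr_eq0/= => /eqP.
rewrite mxtrace_mulC mxtr_symp ?tr_lyap// => tr0.
by apply: mxtr_mul_tr_eq0; rewrite tr_lyap.
Qed.

(** Transposition reverses a word in symmetric matrices without changing its trace; [G] and [H]
    select a cyclic rotation of the reversed word. *)
Lemma mxtr_rev6 (A B C D E F : symmx R n) (G H : 'M[R]_n) :
  H *m G = F *m E *m D *m C *m B *m A ->
  \tr (A *m B *m C *m D *m E *m F) = \tr (G *m H).
Proof.
move=> defHG; rewrite [RHS]mxtrace_mulC defHG -[LHS]mxtrace_tr !trmx_mul !symmxE.
by rewrite !mulmxA.
Qed.

(* With [P], [Q], [W] the Lyapunov solutions for [S], [T], [U], every trace   *)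
(* but those containing [U] itself cancels against its reversal.              *)
Lemma christoffel_trace (X U P Q W : symmx R n) :
  \tr ((2 *: (X *m symp (W *m M *m P) *m M)
         - (M *m P *m U + M *m W *m lyap_op M X P)) *m Q) +
  \tr ((2 *: (X *m symp (W *m M *m Q) *m M)
         - (M *m Q *m U + M *m W *m lyap_op M X Q)) *m P) =
  - \tr (lyap_op M U P *m Q).
Proof.
have symp2 L : 2 *: (X *m symp L *m M) = X *m L *m M + X *m L^T *m M.
  rewrite /symp -scalemxAr -scalemxAl scalerA divff ?pnatr_eq0// scale1r.
  by rewrite mulmxDr mulmxDl.
rewrite !symp2 !trmx_mul !symmxE /lyap_op !mulmxDl !mulmxDr !mulNmx !mulmxDl.
have trN (A : 'M[R]_n) : \tr (- A) = - \tr A by exact: linearN.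
rewrite !mxtraceD !trN !mxtraceD !mulmxA.
rewrite (mxtr_rev6 (A := X) (B := P) (C := M) (D := W) (E := M) (F := Q)
  (G := M *m W *m M *m P *m X) (H := Q)) ?mulmxA//.
rewrite (mxtr_rev6 (A := X) (B := Q) (C := M) (D := W) (E := M) (F := P)
  (G := M *m W *m M *m Q *m X) (H := P)) ?mulmxA//.
rewrite (mxtr_rev6 (A := X) (B := W) (C := M) (D := P) (E := M) (F := Q)
  (G := M *m W *m X) (H := Q *m M *m P)) ?mulmxA//.
rewrite (mxtr_rev6 (A := X) (B := W) (C := M) (D := Q) (E := M) (F := P)
  (G := M *m W *m X) (H := P *m M *m Q)) ?mulmxA//.
have -> : \tr (M *m Q *m U *m P) = \tr (U *m P *m M *m Q).
  by rewrite -[X in \tr X]mulmxA mxtrace_mulC !mulmxA.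
lra.
Qed.

Definition christoffel X U S : symmx R n :=
  sym_part (2 *: (X *m symp (lyap X M U *m M *m lyap X M S) *m M)
            - (M *m lyap X M S *m U + M *m lyap X M U *m S)).

Lemma christoffel_sym X U S : posdef X -> christoffel X U S = christoffel X S U.
Proof.
move=> hX; rewrite /christoffel -symp_tr !trmx_mul symmxE !tr_lyap// !mulmxA.
by rewrite [X in _ - X]addrC.
Qed.

Lemma christoffel_linear X S : posdef X -> linear (christoffel X ^~ S).
Proof.
move=> hX a U1 U2; rewrite /christoffel -linearP; congr sym_part.
have -> : symp (lyap X M (a *: U1 + U2) *m M *m lyap X M S) =
    a *: symp (lyap X M U1 *m M *m lyap X M S) +
    symp (lyap X M U2 *m M *m lyap X M S).
  by rewrite -symp_linear; congr symp; rewrite lyap_linear// !mulmxDl -!scalemxAl.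
rewrite lyap_linear// -[symmx_val (a *: U1 + U2)]
  /(a *: symmx_val U1 + symmx_val U2).
move: (symp (lyap X M U1 *m _ *m _)) (symp (lyap X M U2 *m _ *m _)) => A1 A2.
rewrite !mulmxDr !mulmxDl -!scalemxAr -!scalemxAl.
rewrite scalerDr [2 *: (a *: _)]scalerA [2 * a]mulrC -scalerA scalerBr.
rewrite scalerDr.
by rewrite [X in _ - X = _]addrACA opprD addrACA.
Qed.

Lemma christoffel_linearr X U : posdef X -> linear (christoffel X U).
Proof.
move=> hX a S T; rewrite christoffel_sym// christoffel_linear//.
by rewrite ![_ X _ U]christoffel_sym.
Qed.

Lemma christoffelDr X U S T : posdef X ->
  christoffel X U (S + T) = christoffel X U S + christoffel X U T.
Proof.
by move=> hX; have := christoffel_linearr U hX 1 S T; rewrite !scale1r.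
Qed.

Lemma christoffelZr X U a S : posdef X ->
  christoffel X U (a *: S) = a *: christoffel X U S.
Proof.
move=> hX; have := christoffel_linearr U hX a S 0; rewrite addr0 => ->.
suff -> : christoffel X U 0 = 0 by rewrite addr0.
by have := christoffel_linearr U hX (-1) 0 0; rewrite scaler0 addr0 scaleN1r addNr.
Qed.

Lemma christoffel_continuous (T : symmx R n -> symmx R n) X U :
  posdef X -> differentiable T X ->
  {for X, continuous (fun Y => christoffel Y U (T Y))}.
Proof.
move=> hX /differentiableP dT.
have dU := is_diff_lyap hX (is_diff_cst U X); have dL := is_diff_lyap hX dT.
by apply: differentiable_continuous; apply: ex_diff.
Qed.

(** The right-hand side is the derivative along [U] of the metric on constant fields [S] and [T], so
    this is metric compatibility. *)
Lemma christoffel_metric X U S T : posdef X ->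
  gbw M X (christoffel X U S) T + gbw M X S (christoffel X U T) =
  - (2^-1 * \tr (lyap_op M U (lyap X M S) *m lyap X M T)).
Proof.
move=> hX; rewrite gbw_sym// !gbwE -mulrDr -mulrN; congr (_ * _).
rewrite ![\tr (_ *m symmx_val _)]mxtrace_mulC !mxtr_symp ?tr_lyap//.
(* Expressing every tangent vector through its symmetric Lyapunov solution leaves a pure trace
   identity. *)
have lyapS V : exists2 L : symmx R n,
    symmx_val L = lyap X M V & symmx_val V = lyap_op M X L.
  exists (sym_part (lyap X M V)); last first.
    by rewrite /= symp_id ?tr_lyap// lyapP.
  by rewrite /= symp_id ?tr_lyap.
have [P <- ->] := lyapS S; have [Q <- ->] := lyapS T; have [W <- _] := lyapS U.
exact: christoffel_trace.
Qed.

Definition gbw_connection X U (T : symmx R n -> symmx R n) : symmx R n :=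
  'd T X U + christoffel X U (T X).

Lemma is_diff_gbw (S T dS dT : symmx R n -> symmx R n) X : posdef X ->
  is_diff X S dS -> is_diff X T dT ->
  is_diff X (fun Y => gbw M Y (S Y) (T Y))
    (fun U => gbw M X (dS U) (T X) + gbw M X (S X) (dT U)
       - 2^-1 * \tr (lyap_op M U (lyap X M (S X)) *m lyap X M (T X))).
Proof.
move=> hX dSX dTX; have dL := is_diff_lyap hX dSX.
have := is_diff_mxtrace (is_diff_mulmx dL (is_diff_symmx_val dTX)).
move=> /(is_diffZ (2^-1 : R)) dg.
apply: is_diff_eq dg _; apply/funext => U.
rewrite !gbwE /= scalrfctE -mulrDr -mulrBr; congr (_ * _).
(* Self-adjointness moves the inverse operator from the derivative of the Lyapunov solution onto
   [T X]. *)
have -> : \tr (lyap_op M U (lyap X M (S X)) *m lyap X M (T X)) =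
    \tr (lyap_inv M X (lyap_op M U (lyap X M (S X))) *m T X).
  by rewrite -[in RHS](lyapP M_posdef (T X) hX) mxtr_lyap_op lyap_invK.
rewrite linearB mulmxBl 2!mxtraceD (linearN (@mxtrace R n)).
by rewrite [lyap X M (dS U)]lyapE// addrCA addrA.
Qed.

Lemma gbw_connection_levi_civita :
  is_levi_civita posdef (gbw M) gbw_connection.
Proof.
split.
- split => /=.
  + move=> T X a U1 U2 T1 hX.
    by rewrite /gbw_connection linearP christoffel_linear// scalerDr addrACA.
  + move=> S T X U S1 T1 hX.
    have [dS _] := S1 X hX; have [dT _] := T1 X hX.
    have dST : 'd (fun Y => S Y + T Y) X U = 'd S X U + 'd T X U.
      exact: (f_equal (@^~ U) (diffD dS dT)).
    apply: etrans (congr1 (fun Z => Z + christoffel X U (S X + T X)) dST) _.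
    by rewrite christoffelDr// addrACA.
  + move=> h T X U h1 T1 hX.
    have [/differentiableP dh _] := h1 X hX.
    have [/differentiableP dT _] := T1 X hX.
    have dhT : 'd (fun Y => h Y *: T Y) X U = 'd h X U *: T X + h X *: 'd T X U.
      have dhT := is_diff_scalar_mul dh dT.
      exact: (f_equal (@^~ U) (@diff_val _ _ _ _ _ _ _ dhT)).
    apply: etrans (congr1 (fun Z => Z + christoffel X U (h X *: T X)) dhT) _.
    by rewrite christoffelZr// scalerDr addrA.
  + move=> T X U T1 hX; have [dT dTc] := T1 X hX.
    apply: (@cvgD _ _ _ (nbhs X)); first exact: dTc.
    exact: christoffel_continuous.
- move=> S T X S1 T1 hX; rewrite /gbw_connection (christoffel_sym (S X))//.
  by rewrite opprD addrACA subrr addr0.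
- move=> S T X U S1 T1 hX.
  have [dS _] := S1 X hX; have [dT _] := T1 X hX.
  have dg := is_diff_gbw hX (differentiableP dS) (differentiableP dT).
  apply: etrans (f_equal (@^~ U) (@diff_val _ _ _ _ _ _ _ dg)) _.
  rewrite -christoffel_metric//.
  by rewrite /gbw_connection gbwDl// gbwDr// addrACA.
Qed.

End gbw_metric.

(** * Euclidean and Riemannian gradients, and their derivatives *)

Section euclidean_gradient.
Variables (R : realType) (n : nat).
Implicit Types (X U G : symmx R n) (f : symmx R n -> R).

Let e (i j : 'I_n) : symmx R n := sym_part (delta_mx i j).

Lemma mxtr_sqr_eq0 G : \tr (G *m G) = 0 -> G = 0.
Proof.
by move=> trG0; apply/val_inj/mxtr_mul_tr_eq0; rewrite symmxE.
Qed.

Lemma egrad_unique f X G :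
  (forall U, \tr (G *m U) = 'd f X U) -> egrad f X = G.
Proof.
move=> hG; rewrite /egrad; set P := (X in xget _ X).
have hP : P (xget 0 P) by apply: xgetPex; exists G.
apply/eqP; rewrite -subr_eq0; apply/eqP/mxtr_sqr_eq0.
have := hP (xget 0 P - G); rewrite -hG => /eqP.
by rewrite -subr_eq0 -linearB /= -mulmxBl => /eqP.
Qed.

(** The symmetrized matrix units form a redundant spanning family, yet U is the sum of the U_ij
    e_ij, and tr(e_ij U) = U_ij by symmetry of U. *)
Lemma mxtr_riesz (F : {linear symmx R n -> R^o}) U :
  \tr ((\sum_i \sum_j F (e i j) *: e i j : symmx R n) *m U) = F U.
Proof.
have {2}-> : U = \sum_i \sum_j symmx_val U i j *: e i j.
  rewrite -[LHS]sym_partK {1}(matrix_sum_delta U) linear_sum.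
  apply: eq_bigr => i _; rewrite linear_sum; apply: eq_bigr => j _.
  by rewrite linearZ.
rewrite [RHS]linear_sum (linear_sum (@symmx_val R n)) mulmx_suml linear_sum.
apply: eq_bigr => i _.
rewrite [RHS]linear_sum (linear_sum (@symmx_val R n)) mulmx_suml linear_sum.
apply: eq_bigr => j _.
rewrite [RHS]linearZ (linearZ_LR (@symmx_val R n)) -scalemxAl linearZ /= mulrC.
congr (_ * _); rewrite mxtr_symp ?symmxE// mxtrace_mulC.
rewrite /mxtrace (bigD1 j)//= big1 ?addr0 => [|k kj]; last first.
  rewrite mxE big1// => l _; rewrite mxE (negbTE kj) andbF mulr0//.
rewrite mxE (bigD1 i)//= big1 ?addr0 => [|k ki]; last first.
  by rewrite mxE (negbTE ki) mulr0.
by rewrite mxE !eqxx mulr1 -[in LHS](symmxE U) mxE.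
Qed.

(** Since ['d f X] is linear at every point, this is an equality of functions; it reduces the
    regularity of the gradient to that of finitely many directional derivatives. *)
Lemma egradE f X : egrad f X = \sum_i \sum_j 'd f X (e i j) *: e i j.
Proof. by apply: egrad_unique => U; exact: mxtr_riesz. Qed.

Lemma egradP f X U : \tr (egrad f X *m U) = 'd f X U.
Proof. by rewrite egradE; exact: mxtr_riesz. Qed.

Lemma ehess_is_diff f X : C2_on posdef f -> posdef X ->
  is_diff X (egrad f)
    (fun U => \sum_i \sum_j 'd (fun Y => 'd f Y (e i j)) X U *: e i j).
Proof.
move=> [_ f2] hX.
have -> : egrad f = fun Y => \sum_i \sum_j 'd f Y (e i j) *: e i j.
  by apply/funext => Y; exact: egradE.
apply: is_diff_sum => i; apply: is_diff_sum => j; apply: is_diff_scalel_fun.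
by have [/differentiableP] := f2 (e i j) X hX.
Qed.

Lemma egrad_C1 f : C2_on posdef f -> C1_on posdef (egrad f).
Proof.
move=> f2; apply: C1_on_is_diff => [X hX|X hX|X U hX].
- exact: posdef_near.
- exact: ehess_is_diff.
apply: continuous_sum => i; apply: continuous_sum => j.
have [_ f2'] := f2; have [_ /(_ U) d2fc] := f2' (e i j) X hX.
exact: (@cvgZr_tmp _ _ _ (nbhs X) _ _ _ (e i j) d2fc).
Qed.

Variables (M : symmx R n) (M_posdef : posdef M).

Definition gbw_grad_formula f X : symmx R n :=
  sym_part (4 *: (X *m egrad f X *m M)).

Lemma gbw_grad_formulaE f X : symmx_val (gbw_grad_formula f X) =
  2 *: (X *m egrad f X *m M) + 2 *: (M *m egrad f X *m X).
Proof.
rewrite /= /symp linearZ /= !trmx_mul !symmxE !mulmxA -scalerDr scalerA.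
by rewrite scalerDr; congr (_ *: _ + _ *: _); field.
Qed.

Lemma lyap_gbw_grad_formula f X :
  posdef X -> lyap X M (gbw_grad_formula f X) = 2 *: symmx_val (egrad f X).
Proof.
move=> hX; apply: lyap_unique => //.
by rewrite gbw_grad_formulaE linearZ/= /lyap_op scalerDr.
Qed.

(** The factor 1/2 of the metric cancels the 2 in [lyap_gbw_grad_formula], so the formula represents
    the differential; nondegeneracy makes it the only such vector. *)
Lemma gbw_gradE f X : posdef X -> gbw_grad M f X = gbw_grad_formula f X.
Proof.
move=> hX; rewrite /gbw_grad /rgrad; set P := (X in xget _ X).
have PG : P (gbw_grad_formula f X).
  move=> U; rewrite gbwE lyap_gbw_grad_formula// -scalemxAl mxtraceZ mulrA.
  by rewrite mulVf ?pnatr_eq0// mul1r; exact: egradP.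
have hP := xgetI 0 PG.
apply/eqP; rewrite -subr_eq0; apply/eqP.
apply: (gbw_nondeg M_posdef hX) => U; rewrite gbwBl//.
by apply/eqP; rewrite subr_eq0; apply/eqP/(etrans (hP U)); rewrite PG.
Qed.

Lemma is_diff_gbw_grad f X : C2_on posdef f -> posdef X ->
  is_diff X (gbw_grad M f) (fun U =>
    sym_part (4 *: ((X *m ehess f X U + U *m egrad f X) *m M))).
Proof.
move=> f2 hX.
have [/differentiableP dG _] := egrad_C1 f2 hX.
apply: (@is_diff_near_eq _ _ _ _ (gbw_grad_formula f)).
  by apply: filterS (posdef_near hX) => Y; exact: gbw_gradE.
have dvG := is_diff_symmx_val dG.
apply: is_diff_eq; apply/funext => U.
(* The product rule leaves a summand with the derivative of the constant [M], which is zero. *)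
rewrite scalrfctE; congr (sym_part (4 *: _)); rewrite -[RHS]add0r.
by congr (_ + _); exact: mulmx0.
Qed.

Lemma gbw_grad_C1 f : C2_on posdef f -> C1_on posdef (gbw_grad M f).
Proof.
move=> f2; apply: C1_on_is_diff => [X hX|X hX|X U hX].
- exact: posdef_near.
- exact: is_diff_gbw_grad.
have [dG /(_ U) dGc] := egrad_C1 f2 hX.
have Gc := differentiable_continuous dG.
have idc : {for X, continuous (fun Y : symmx R n => symmx_val Y)}.
  exact: symmx_val_continuous.
have cstc (A : 'M[R]_n) : {for X, continuous (fun _ : symmx R n => A)}.
  exact: cst_continuous.
have vGc : {for X, continuous (fun Y => symmx_val (egrad f Y))}.
  by apply: (cvg_comp _ _ Gc); exact: symmx_val_continuous.
have vHc : {for X, continuous (fun Y => symmx_val (ehess f Y U))}.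
  by apply: (cvg_comp _ _ dGc); exact: symmx_val_continuous.
have Ac : {for X, continuous
    (fun Y : symmx R n => Y *m ehess f Y U + U *m egrad f Y)}.
  apply: (@cvgD _ _ _ (nbhs X)); first exact: (continuous_mulmx idc vHc).
  exact: (continuous_mulmx (cstc U) vGc).
apply: (cvg_comp _ (fun A => sym_part (4 *: A)) (continuous_mulmx Ac (cstc M))).
exact: (@mx_linear_continuous _ _ _ _ (@sym_part R n \o *:%R 4)).
Qed.

(** As [gbw_connection] is a Levi-Civita connection, the description [levi_civita] yields one too,
    and by uniqueness the two agree on the C^1 gradient field. *)
Lemma gbw_hessE f X U : C2_on posdef f -> posdef X ->
  gbw_hess M f X U =
  sym_part (4 *: ((X *m ehess f X U + U *m egrad f X) *m M))
  + christoffel M X U (gbw_grad M f X).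
Proof.
move=> f2 hX; rewrite /gbw_hess /rhess.
have LC := gbw_connection_levi_civita M_posdef.
have LC' := xgetI (fun _ _ _ => 0) LC.
apply: etrans (levi_civita_unique _ _ _ LC' LC U hX (gbw_grad_C1 f2)) _.
- by move=> Y A B W; exact: gbwBl.
- by move=> Y A B; exact: gbw_sym.
- by move=> Y A; exact: gbw_nondeg.
apply: (congr1 (+%R^~ _)).
exact: (f_equal (@^~ U) (@diff_val _ _ _ _ _ _ _ (is_diff_gbw_grad f2 hX))).
Qed.

End euclidean_gradient.

(** * Symmetrized algebra and the two formulas *)

(** Words are reversed under [symp] by transposition. The coefficient 2 of {M G U}_S is 4 from
    differentiating the gradient minus 2 from the Christoffel term, where 2 G is the Lyapunov
    solution for the gradient. *)
Lemma symp_hess (R : realType) (n : nat) (X M U G H N : symmx R n)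
  (L : 'M[R]_n) : L^T = L ->
  symp (4 *: ((X *m H + U *m G) *m M)) +
  symp (2 *: (X *m symp (L *m M *m (2 *: symmx_val G)) *m M)
        - (M *m (2 *: symmx_val G) *m U + M *m L *m N)) =
  4 *: symp (M *m H *m X) + 2 *: symp (M *m G *m U)
  + 4 *: symp (X *m symp (G *m M *m L) *m M) - symp (M *m L *m N).
Proof.
move=> symL.
have sympZ a (A : 'M[R]_n) : symp (a *: A) = a *: symp A by exact: linearZ.
have sympD (A B : 'M[R]_n) : symp (A + B) = symp A + symp B by exact: linearD.
have sympN (A : 'M[R]_n) : symp (- A) = - symp A by exact: linearN.
have e1 : symp (X *m H *m M) = symp (M *m H *m X).
  by rewrite -symp_tr !trmx_mul !symmxE mulmxA.
have e2 : symp (U *m G *m M) = symp (M *m G *m U).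
  by rewrite -symp_tr !trmx_mul !symmxE mulmxA.
have e3 : symp (L *m M *m G) = symp (G *m M *m L).
  by rewrite -symp_tr !trmx_mul !symmxE symL mulmxA.
have e4 : symp (L *m M *m (2 *: symmx_val G)) = 2 *: symp (G *m M *m L).
  by rewrite -e3 -sympZ scalemxAr.
rewrite e4; move: (symp (G *m M *m L)) => Q.
rewrite -!scalemxAr -!scalemxAl.
rewrite [symp (4 *: _)]sympZ mulmxDl [symp (X *m H *m M + _)]sympD e1 e2.
rewrite [symp (_ - _)]sympD sympN [symp (2 *: (M *m G *m U) + _)]sympD.
rewrite scalerA [symp (_ *: (X *m Q *m M))]sympZ [symp (2 *: (M *m G *m U))]sympZ.
move: (symp (M *m H *m X)) (symp (M *m G *m U)) => Z1 Z2.
move: (symp (X *m Q *m M)) (symp (M *m L *m N)) => Z3 Z4.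
by apply/matrixP => i j; rewrite !mxE; ring.
Qed.

Unset Implicit Arguments.

Theorem proposition5 (R : realType) (n : nat) (M : symmx R n)
    (hM : posdef M) (f : symmx R n -> R) (hf : C2_on posdef f)
    (X : symmx R n) (hX : posdef X) :
  (gbw_grad M f X : 'M[R]_n) =
    2 *: (X *m egrad f X *m M) + 2 *: (M *m egrad f X *m X)
  /\
  forall U : symmx R n,
    (gbw_hess M f X U : 'M[R]_n) =
      4 *: symp (M *m ehess f X U *m X)
      + 2 *: symp (M *m egrad f X *m U)
      + 4 *: symp (X *m symp (egrad f X *m M *m lyap X M U) *m M)
      - symp (M *m lyap X M U *m gbw_grad M f X).
Proof.
split=> [|U]; first by rewrite gbw_gradE// gbw_grad_formulaE.
rewrite gbw_hessE// -symp_hess ?tr_lyap//.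
by rewrite /christoffel [in LHS]gbw_gradE// lyap_gbw_grad_formula// -gbw_gradE.
Qed.
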